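(* Let $(C,d)$ be a diamond chain complex whose basis graph $\Gamma$ is connected with rank $r$, and let $\mathbb F_p$ be a field of characteristic $p$ ($p$ a prime or $p=0$). If $r\not\equiv0\bmod p$ in case $p>0$, and $r\neq0$ in case $p=0$, then $$H_*(C;\mathbb F_p)=0,\qquad H^*(C;\mathbb F_p)=0.$$
   Context: Graphs are finite simple graphs. A graph $\Gamma$ is a diamond graph if: whenever $a,b,c$ are distinct vertices such that $\{a,b\}$ and $\{b,c\}$ are edges, there is a unique vertex $d\neq b$ such that $\{a,d\}$ and $\{d,c\}$ are edges and $\{a,c\}$ and $\{b,d\}$ are not edges; the full subgraph on $\{a,b,c,d\}$ is a diamond $\langle a;b;c;d\rangle$. It is admissible if there is a sign function $\phi$ from its edges to $\{\pm1\}$ with $\phi(a,b)\phi(b,c)+\phi(a,d)\phi(d,c)=0$ for every diamond $\langle a;b;c;d\rangle$. All vertices of a connected diamond graph have the same number of neighbors; this number is its rank. A diamond chain complex $(C,d)$ with basis graph $\Gamma$ is a chain complex such that $\Gamma$ is an admissible diamond graph with sign function $\phi$, with vertices graded so that $|a|=|b|\pm1$ for every edge $\{a,b\}$; $C=\mathbb Z(\Gamma)$ is the free abelian group on the vertices of $\Gamma$; and $da=\sum_{|b|=|a|-1,\ \{a,b\}\text{ an edge}}\phi(a,b)\,b$ for every vertex $a$. The dual cochain complex $(C,\delta)$ is regarded as the same group with $\delta a=\sum_{|b|=|a|+1,\ \{a,b\}\text{ an edge}}\phi(a,b)\,b$. $H_*(C;\mathbb F)=H_*(C\otimes\mathbb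 F,d)$ and $H^*(C;\mathbb F)=H^*(C\otimes\mathbb F,\delta)$. *)

(* Defs.v *)
From HB Require Import structures.
From mathcomp Require Import all_boot all_order all_algebra zify.

Set Implicit Arguments.
Unset Strict Implicit.
Unset Printing Implicit Defensive.

Import GRing.Theory.
Local Open Scope ring_scope.

Record sgraph := SGraph {
  vertex :> finType;
  edge : rel vertex;
  edge_sym : symmetric edge;
  edge_irr : irreflexive edge
}.
Arguments edge {s} _ _.

Section Graphs.
Variable G : sgraph.

Definition diamond_graph : Prop :=
  forall a b c : G, uniq [:: a; b; c] -> edge a b -> edge b c ->
  exists! d : G,
    [/\ d != b, edge a d, edge d c, ~~ edge a c & ~~ edge b d].

Definition is_diamond (a b c d : G) : bool :=
  [&& uniq [:: a; b; c; d],
      edge a b, edge b c, edge c d, edge d a, ~~ edge a c & ~~ edge b d].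

(* A function on the (unordered) edges is encoded as a function on ordered
   pairs that is symmetric on edges; its values on non-edges are junk. *)
Definition sign_function (phi : G -> G -> int) : Prop :=
  [/\ forall a b : G, edge a b -> phi a b = 1 \/ phi a b = -1,
      forall a b : G, edge a b -> phi a b = phi b a
    & forall a b c d : G, is_diamond a b c d ->
        phi a b * phi b c + phi a d * phi d c = 0].

(* The empty graph is not excluded; it is connected and [has_rank] every r. *)
Definition connected_graph : Prop := forall a b : G, connect edge a b.

Definition has_rank (r : nat) : Prop :=
  forall a : G, #|[set b : G | edge a b]| = r.

End Graphs.

(* The group and the differentials are determined by these data; they are
   [chains], [bd] and [cobd] below, and [bd_bd], [cobd_cobd] show that they
   square to zero. *)
Record diamond_complex := DiamondComplex {
  basis_graph :> sgraph;
  deg : basis_graph -> int;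
  sgn : basis_graph -> basis_graph -> int;
  basis_diamond : diamond_graph basis_graph;
  sgn_sign : sign_function sgn;
  deg_edge : forall a b : basis_graph,
    edge a b -> deg a = deg b + 1 \/ deg a = deg b - 1
}.
Arguments deg {d} _.
Arguments sgn {d} _ _.

Section Chains.
Variables (C : diamond_complex) (R : comNzRingType).

(* The free R-module on the vertices: Z(Gamma) for R = int, and in general
   Z(Gamma) (x) R; [bd_intr] and [cobd_intr] below say that the differentials
   over R are obtained from those over int by extension of scalars. *)
Definition chains := {ffun C -> R^o}.

Definition gen (a : C) : chains := [ffun x => (x == a)%:R].

Definition bd_gen (a : C) : chains :=
  \sum_(b : C | (deg b == deg a - 1) && edge a b) (sgn a b)%:~R *: gen b.

Definition cobd_gen (a : C) : chains :=
  \sum_(b : C | (deg b == deg a + 1) && edge a b) (sgn a b)%:~R *: gen b.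

Definition bd (c : chains) : chains := \sum_(a : C) c a *: bd_gen a.

Definition cobd (c : chains) : chains := \sum_(a : C) c a *: cobd_gen a.

Fact bd_linear : linear bd.
Proof.
move=> k u v; rewrite /bd scaler_sumr -big_split; apply: eq_bigr => a _ /=.
by rewrite !ffunE scalerDl scalerA.
Qed.
HB.instance Definition _ := GRing.isLinear.Build R chains chains _ bd bd_linear.

Fact cobd_linear : linear cobd.
Proof.
move=> k u v; rewrite /cobd scaler_sumr -big_split; apply: eq_bigr => a _ /=.
by rewrite !ffunE scalerDl scalerA.
Qed.
HB.instance Definition _ :=
  GRing.isLinear.Build R chains chains _ cobd cobd_linear.

Lemma gen_lincomb (P : pred C) (k : C -> R) (x : C) :
  (\sum_(b | P b) (k b : R) *: gen b : chains) x = if P x then k x else 0.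
Proof.
rewrite sum_ffunE big_mkcond (bigD1 x) //= big1 => [|b /negPf nbx].
  by rewrite !ffunE eqxx addr0 /GRing.scale /= mulr1.
by case: ifP => // _; rewrite !ffunE eq_sym nbx scaler0.
Qed.

Lemma bd_genE (a : C) : bd (gen a) = bd_gen a.
Proof.
rewrite /bd (bigD1 a) //= big1 => [|b /negPf nba]; rewrite !ffunE.
  by rewrite eqxx scale1r addr0.
by rewrite nba scale0r.
Qed.

Lemma cobd_genE (a : C) : cobd (gen a) = cobd_gen a.
Proof.
rewrite /cobd (bigD1 a) //= big1 => [|b /negPf nba]; rewrite !ffunE.
  by rewrite eqxx scale1r addr0.
by rewrite nba scale0r.
Qed.

End Chains.

Section SquareZero.
Variable C : diamond_complex.

Lemma edge_neq (G : sgraph) (x y : G) : edge x y -> x != y.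
Proof. by case: eqVneq => // ->; rewrite edge_irr. Qed.

Lemma two_step_sum (s : int) (a c : C) : s != 0 ->
  \sum_(b : C | ((deg b == deg a + s) && edge a b) &&
                ((deg c == deg b + s) && edge b c))
    sgn a b * sgn b c = 0.
Proof.
move=> s0.
set P := fun b : C => ((deg b == deg a + s) && edge a b) &&
                      ((deg c == deg b + s) && edge b c).
rewrite -/(P _); case: (pickP P) => [b Pb|P0]; last by rewrite big_pred0.
have [/andP[/eqP dab eab] /andP[/eqP dbc ebc]] := andP Pb.
have nac : a != c.
  by apply/eqP => eac; move: dbc; rewrite dab eac; clear -s0; lia.
have uabc : uniq [:: a; b; c].
  by rewrite /= !inE negb_or (edge_neq eab) nac (edge_neq ebc).
have [d [[ndb ead edc neac nebd] uniq_d]] := basis_diamond uabc eab ebc.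
have Pd : P d.
  rewrite /P ead edc !andbT.
  move: (deg_edge eab) (deg_edge ead) (deg_edge edc) dab dbc.
  by move: (deg a) (deg b) (deg c) (deg d) => ka kb kc kd; clear; lia.
rewrite (bigD1 b) //= (bigD1 d) /=; last by rewrite ndb andbT; exact: Pd.
rewrite big1 => [|x].
  have [_ _ H] := @sgn_sign C; rewrite addr0; apply: H.
  rewrite /is_diamond eab ebc neac nebd edge_sym edc edge_sym ead /= !inE.
  rewrite !negb_or (edge_neq eab) nac (edge_neq ead) (edge_neq ebc).
  by rewrite (eq_sym b) ndb (eq_sym c) (edge_neq edc).
case/andP=> /andP[Px nxb] /eqP nxd; case: nxd; symmetry; apply: uniq_d.
have [/andP[/eqP dax eax] /andP[_ exc]] := andP Px.
split=> //; apply/negP => /deg_edge; rewrite dax dab; move: (deg a + s) => k.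
by clear; lia.
Qed.

Variable R : comNzRingType.

Lemma bd_bd (c : chains C R) : bd (bd c) = 0.
Proof.
rewrite [X in bd X]/bd linear_sum big1 // => a _; rewrite linearZ /=.
suff -> : bd (bd_gen R a) = 0 by rewrite scaler0.
apply/ffunP => x; rewrite /bd_gen linear_sum sum_ffunE ffunE /=.
transitivity ((\sum_(b : C | ((deg b == deg a - 1) && edge a b) &&
   ((deg x == deg b - 1) && edge b x)) sgn a b * sgn b x)%:~R : R);
  last by rewrite two_step_sum.
rewrite rmorph_sum [RHS]big_mkcondr /=; apply: eq_bigr => b _.
rewrite linearZ /= bd_genE ffunE gen_lincomb.
by case: ifP => _; rewrite ?scaler0 // rmorphM.
Qed.

Lemma cobd_cobd (c : chains C R) : cobd (cobd c) = 0.
Proof.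
rewrite [X in cobd X]/cobd linear_sum big1 // => a _; rewrite linearZ /=.
suff -> : cobd (cobd_gen R a) = 0 by rewrite scaler0.
apply/ffunP => x; rewrite /cobd_gen linear_sum sum_ffunE ffunE /=.
transitivity ((\sum_(b : C | ((deg b == deg a + 1) && edge a b) &&
   ((deg x == deg b + 1) && edge b x)) sgn a b * sgn b x)%:~R : R);
  last by rewrite two_step_sum.
rewrite rmorph_sum [RHS]big_mkcondr /=; apply: eq_bigr => b _.
rewrite linearZ /= cobd_genE ffunE gen_lincomb.
by case: ifP => _; rewrite ?scaler0 // rmorphM.
Qed.

Definition extend_scalars (c : chains C int) : chains C R :=
  [ffun a => (c a)%:~R].

Lemma bd_intr (c : chains C int) :
  bd (extend_scalars c) = extend_scalars (bd c).
Proof.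
apply/ffunP => x; rewrite /bd ffunE !sum_ffunE rmorph_sum.
apply: eq_bigr => a _; rewrite !ffunE !gen_lincomb.
by rewrite [RHS]rmorphM /=; case: ifP => _; rewrite ?rmorph0 // intz.
Qed.

Lemma cobd_intr (c : chains C int) :
  cobd (extend_scalars c) = extend_scalars (cobd c).
Proof.
apply/ffunP => x; rewrite /cobd ffunE !sum_ffunE rmorph_sum.
apply: eq_bigr => a _; rewrite !ffunE !gen_lincomb.
by rewrite [RHS]rmorphM /=; case: ifP => _; rewrite ?rmorph0 // intz.
Qed.

End SquareZero.

(* The quotient Z / (Z :&: B), as an additive group; below, B is always
   contained in Z. *)
Section Subquotient.
Variables (F : fieldType) (V : vectType F) (Z B : {vspace V}).

Definition trivial_class : {pred subvs_of Z} := fun u => vsval u \in B.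

Fact trivial_class_zmod_closed : zmod_closed trivial_class.
Proof.
split; first by rewrite unfold_in /trivial_class linear0 mem0v.
move=> u v uB vB; rewrite unfold_in /trivial_class linearB.
exact: rpredB uB vB.
Qed.
HB.instance Definition _ :=
  GRing.isZmodClosed.Build (subvs_of Z) trivial_class trivial_class_zmod_closed.

Definition subquotient : zmodType := Quotient.quot trivial_class.

End Subquotient.

Section Homology.
Variables (C : diamond_complex) (F : fieldType).

Definition chains_deg (n : int) : {vspace chains C F} :=
  <<[seq gen F a | a in [pred a : C | deg a == n]]>>%VS.

Definition cycles (n : int) : {vspace chains C F} :=
  (chains_deg n :&: lker (linfun (@bd C F)))%VS.

Definition boundaries (n : int) : {vspace chains C F} :=
  (linfun (@bd C F) @: chains_deg (n + 1))%VS.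

Definition cocycles (n : int) : {vspace chains C F} :=
  (chains_deg n :&: lker (linfun (@cobd C F)))%VS.

Definition coboundaries (n : int) : {vspace chains C F} :=
  (linfun (@cobd C F) @: chains_deg (n - 1))%VS.

Definition homology (n : int) : zmodType :=
  subquotient (cycles n) (boundaries n).

Definition cohomology (n : int) : zmodType :=
  subquotient (cocycles n) (coboundaries n).

Lemma boundaries_sub (n : int) : (boundaries n <= cycles n)%VS.
Proof.
rewrite subv_cap; apply/andP; split; last first.
  apply/subvP => _ /memv_imgP[u _ ->].
  by rewrite memv_ker !lfunE /= bd_bd.
rewrite /boundaries limg_span; apply/span_subvP.
move=> _ /mapP[_ /imageP[a /eqP da ->] ->].
rewrite lfunE /= bd_genE; apply: memv_suml => b /andP[/eqP db _].
apply/memvZ/memv_span/image_f; rewrite unfold_in db da; lia.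
Qed.

Lemma coboundaries_sub (n : int) : (coboundaries n <= cocycles n)%VS.
Proof.
rewrite subv_cap; apply/andP; split; last first.
  apply/subvP => _ /memv_imgP[u _ ->].
  by rewrite memv_ker !lfunE /= cobd_cobd.
rewrite /coboundaries limg_span; apply/span_subvP.
move=> _ /mapP[_ /imageP[a /eqP da ->] ->].
rewrite lfunE /= cobd_genE; apply: memv_suml => b /andP[/eqP db _].
apply/memvZ/memv_span/image_f; rewrite unfold_in db da; lia.
Qed.

End Homology.

(* [[pchar F]] is the set of the prime characteristics of F, empty when F has
   characteristic 0. *)
Definition has_characteristic (F : fieldType) (p : nat) : Prop :=
  if p is 0%N then [pchar F] =i pred0 else p \in [pchar F].

(* Main.v *)
Require Import Defs.
From mathcomp Require Import all_boot all_order all_algebra.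
From mathcomp Require Import zify generic_quotient.
Import GRing.Theory.
Local Open Scope ring_scope.

(** The sum D = d + delta sends a vertex [a] to the signed sum of all its
    neighbours.  In D^2 the paths a - b - c with c <> a cancel in pairs, by the
    sign condition on diamonds, while the paths a - b - a contribute r a.
    Since d^2 = delta^2 = 0, this reads d delta + delta d = r, so that
    delta / r and d / r are contracting homotopies as soon as r is invertible. *)

Section Laplacian.
Variable C : diamond_complex.

(* The middle vertices of two paths from [a] to [c] have degrees of the same
   parity, so they are not adjacent. *)
Lemma two_step_non_edge {a b c d : C} :
  edge a b -> edge b c -> edge a d -> ~~ edge a c /\ ~~ edge b d.
Proof.
move=> /deg_edge dab /deg_edge dbc /deg_edge dad.
by split; apply/negP => /deg_edge; lia.
Qed.

(** Once one path a - b - c exists, the diamond property gives exactly one further middle vertex d,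
    so the sum has two terms, which are opposite. *)
Lemma two_step_cancel (a c : C) : a != c ->
  \sum_(b : C | edge a b && edge b c) sgn a b * sgn b c = 0.
Proof.
move=> nac; case: (pickP [pred b | edge a b && edge b c]) => [b|P0].
  2: by rewrite big_pred0.
move=> /= /andP[eab ebc].
have uabc : uniq [:: a; b; c].
  by rewrite /= !inE negb_or (edge_neq eab) nac (edge_neq ebc).
have [d [[ndb ead edc neac nebd] uniq_d]] := basis_diamond uabc eab ebc.
rewrite (bigD1 b) ?eab //= (bigD1 d) ?ead ?edc //= big1 ?addr0 => [|x].
  have [_ _ -> //] := @sgn_sign C.
  rewrite /is_diamond eab ebc neac nebd edge_sym edc edge_sym ead /= !inE.
  rewrite !negb_or (edge_neq eab) nac (edge_neq ead) (edge_neq ebc).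
  by rewrite (eq_sym b) ndb (eq_sym c) (edge_neq edc).
(* A third middle vertex x would also complete the diamond, the non-edges being forced by parity, so
   x = d by uniqueness. *)
case/andP=> /andP[/andP[eax exc] nxb] /eqP[]; apply/esym/uniq_d.
by have [] := two_step_non_edge eab ebc eax.
Qed.

Lemma two_step_return (r : nat) (a : C) : has_rank C r ->
  \sum_(b : C | edge a b && edge b a) sgn a b * sgn b a = r%:R.
Proof.
move=> /(_ a) <-; rewrite -sum1_card natr_sum.
apply: eq_big => [b|b /andP[eab _]]; first by rewrite inE (edge_sym b) andbb.
have [sgnE sgnC _] := @sgn_sign C.
by rewrite -(sgnC _ _ eab); case: (sgnE _ _ eab) => ->.
Qed.

Variable R : comNzRingType.
Implicit Type c : chains C R.

Lemma bd_add_cobd_gen (a : C) :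
  bd (gen R a) + cobd (gen R a) =
  \sum_(b : C | edge a b) (sgn a b)%:~R *: gen R b.
Proof.
rewrite bd_genE cobd_genE; apply/ffunP => x; rewrite ffunE !gen_lincomb.
case: (boolP (edge a x)) => [/deg_edge|]; rewrite ?andbF ?addr0 // !andbT.
(* A neighbour x passes exactly one of the two degree tests; they are solved for [deg a] so that
   [dax] can be substituted. *)
case=> dax; have [-> ->] : (deg x == deg a - 1) = (deg a == deg x + 1) /\
    (deg x == deg a + 1) = (deg a == deg x - 1) by split; lia.
  by rewrite dax eqxx ifN ?addr0 //; lia.
by rewrite dax eqxx ifN ?add0r //; lia.
Qed.

Lemma chains_gen c : c = \sum_(a : C) c a *: gen R a.
Proof. by apply/ffunP => x; rewrite gen_lincomb. Qed.

Lemma bd_add_cobd_square c :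
  bd (bd c + cobd c) + cobd (bd c + cobd c) = bd (cobd c) + cobd (bd c).
Proof. by rewrite !linearD /= bd_bd cobd_cobd add0r addr0. Qed.

Lemma laplacian_gen (r : nat) (a : C) : has_rank C r ->
  bd (cobd (gen R a)) + cobd (bd (gen R a)) = r%:R *: gen R a.
Proof.
move=> rankC; rewrite -bd_add_cobd_square bd_add_cobd_gen.
rewrite !linear_sum -big_split /=.
apply/ffunP => x; rewrite sum_ffunE !ffunE.
(* The coefficient at x is an integer sum over the paths a - b - x, mapped to R. *)
transitivity ((\sum_(b : C | edge a b && edge b x) sgn a b * sgn b x)%:~R : R).
  rewrite rmorph_sum [RHS]big_mkcondr /=; apply: eq_bigr => b _.
  rewrite !linearZ -scalerDr /= bd_add_cobd_gen ffunE gen_lincomb.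
  by case: ifP => _; rewrite ?scaler0 // rmorphM.
have [->|nxa] := eqVneq x a.
  by rewrite (two_step_return r) // /GRing.scale /= mulr1 rmorph_nat.
by rewrite two_step_cancel 1?eq_sym // scaler0.
Qed.

Lemma laplacian (r : nat) c : has_rank C r ->
  bd (cobd c) + cobd (bd c) = r%:R *: c.
Proof.
move=> rankC; rewrite [in RHS](chains_gen c) scaler_sumr.
rewrite [X in bd X]/cobd [X in cobd X]/bd !linear_sum -big_split.
apply: eq_bigr => a _; rewrite !linearZ /= -scalerDr -bd_genE -cobd_genE.
by rewrite (laplacian_gen r) // !scalerA mulrC.
Qed.

End Laplacian.

Lemma subquotient_eq0 (F : fieldType) (V : vectType F) (Z B : {vspace V})
  (h : subquotient Z B) : (Z <= B)%VS -> h = 0.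
Proof.
move=> /subvP ZB; elim/quotW: h => u.
apply/eqP; rewrite !piE Quotient.equivE subr0.
exact/ZB/subvsP.
Qed.

Lemma natr_neq0_of_char (F : fieldType) (p r : nat) : has_characteristic F p ->
  ((0 < p)%N -> ~ (r = 0 %[mod p])%N) -> (p = 0%N -> r <> 0%N) -> r%:R != 0 :> F.
Proof.
case: p => [/pcharf0P -> _ /(_ erefl) /eqP //|p charF /(_ isT) nr _].
rewrite -(dvdn_pcharf charF); apply/negP => /eqP rp.
by apply: nr; rewrite rp mod0n.
Qed.

Section Acyclicity.
Variables (C : diamond_complex) (F : fieldType) (r : nat).
Hypotheses (rankC : has_rank C r) (rF : r%:R != 0 :> F).

(** The degree shift is read off from [coboundaries_sub]: [cobd c] is a coboundary, hence a cocycle,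
    in degree n + 1. *)
Lemma cobd_chains_deg (n : int) (c : chains C F) :
  c \in chains_deg C F n -> cobd c \in chains_deg C F (n + 1).
Proof.
move=> cn; have /subvP/(_ (cobd c)) := coboundaries_sub C F (n + 1).
rewrite memv_cap => /(_ _)/andP[] //.
by apply/memv_imgP; exists c; rewrite ?addrK ?lfunE.
Qed.

Lemma bd_chains_deg (n : int) (c : chains C F) :
  c \in chains_deg C F n -> bd c \in chains_deg C F (n - 1).
Proof.
move=> cn; have /subvP/(_ (bd c)) := boundaries_sub C F (n - 1).
rewrite memv_cap => /(_ _)/andP[] //.
by apply/memv_imgP; exists c; rewrite ?subrK ?lfunE.
Qed.

Lemma cycles_sub_boundaries (n : int) : (cycles C F n <= boundaries C F n)%VS.
Proof.
apply/subvP => z; rewrite memv_cap memv_ker lfunE => /andP[zn /= /eqP bdz].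
(* As [bd z] = 0, the Laplacian identity reduces to [bd (cobd z)] = r z, so dividing by r gives a
   preimage of z. *)
apply/memv_imgP; exists (r%:R^-1 *: cobd z); first exact/memvZ/cobd_chains_deg.
have := laplacian C F r z rankC; rewrite bdz linear0 addr0 lfunE linearZ /= => ->.
by rewrite scalerK.
Qed.

Lemma cocycles_sub_coboundaries (n : int) :
  (cocycles C F n <= coboundaries C F n)%VS.
Proof.
apply/subvP => z; rewrite memv_cap memv_ker lfunE => /andP[zn /= /eqP cobdz].
(* Dually, [cobd z] = 0 leaves [cobd (bd z)] = r z. *)
apply/memv_imgP; exists (r%:R^-1 *: bd z); first exact/memvZ/bd_chains_deg.
have := laplacian C F r z rankC; rewrite cobdz linear0 add0r lfunE linearZ /= => ->.
by rewrite scalerK.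
Qed.

End Acyclicity.

Theorem theorem6p4 (C : diamond_complex) (r p : nat) (F : fieldType)
    (connC : connected_graph C) (rankC : has_rank C r)
    (charF : has_characteristic F p)
    (r_pos_char : (0 < p)%N -> ~ (r = 0 %[mod p])%N)
    (r_char0 : p = 0%N -> r <> 0%N) :
  (forall (n : int) (h : homology C F n), h = 0) /\
  (forall (n : int) (h : cohomology C F n), h = 0).
Proof.
have rF := natr_neq0_of_char F p r charF r_pos_char r_char0.
split=> n h; apply: subquotient_eq0.
  exact: cycles_sub_boundaries C F r rankC rF n.
exact: cocycles_sub_coboundaries C F r rankC rF n.
Qed.
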